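(* Let $\boldsymbol B,\boldsymbol E:\mathbb{R}^3\to\mathbb{R}^3$ be the magnetic and electric field, fix $\boldsymbol x_0\in\mathbb{R}^3$, and let $X$, $L$, $F$ and the one-step map $\Phi_h:X\times X\to X\times X$ of the symmetric exponential integrator be as defined in the context. Let $V_1,V_2,W_1,W_2\in X$ and put $\mathcal V=(V_1,V_2)^T$, $\mathcal W=(W_1,W_2)^T$. Then there is a constant $C>0$, independent of $h$, such that for $h\in(0,1]$ $$\|\Phi_h(\mathcal V)-\Phi_h(\mathcal W)\|\le(1+Ch)\,\|\mathcal V-\mathcal W\|.$$
   Context: Write $\boldsymbol B=(B_1,B_2,B_3)$, $\boldsymbol E=(E_1,E_2,E_3)$, and let $i$ be the imaginary unit. The state space is $$X=\{(\boldsymbol x,t,\boldsymbol v,w)^T:\ \boldsymbol x,\boldsymbol v\in\mathbb{R}^3,\ t,w\in i\mathbb{R}\}\subset\mathbb{C}^8,$$ a real vector space of dimension 8, identified with $\mathbb{R}^4\times\mathbb{R}^4$ (the ''time'' variables $t$ and $w$ are purely imaginary). All norms $\|\cdot\|$ are Euclidean norms on $\mathbb{C}^8$ and $\mathbb{C}^{16}$. For $\boldsymbol x\in\mathbb{R}^3$ define (fields evaluated at $\boldsymbol x$) $$\widehat B(\boldsymbol x)=\begin{pmatrix}0&B_3&-B_2&0\\ -B_3&0&B_1&0\\ B_2&-B_1&0&0\\ 0&0&0&0\end{pmatrix},\qquad \widehat E(\boldsymbol x)=\begin{pmatrix}0&0&0&-iE_1\\ 0&0&0&-iE_2\\ 0&0&0&-iE_3\\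 iE_1&iE_2&iE_3&0\end{pmatrix}.$$ For the fixed point $\boldsymbol x_0\in\mathbb{R}^3$ (the initial position) set $$G(\boldsymbol x)=\widehat B(\boldsymbol x)-\widehat B(\boldsymbol x_0)+\widehat E(\boldsymbol x),\qquad L=\begin{pmatrix}0&I_4\\ 0&\widehat B(\boldsymbol x_0)\end{pmatrix}\in\mathbb{R}^{8\times 8},$$ and for $U=(\boldsymbol x,t,\boldsymbol v,w)^T\in X$, with $\boldsymbol u=(\boldsymbol v,w)^T$, set $$F(U)=\begin{pmatrix}0\\ G(\boldsymbol x)\boldsymbol u\end{pmatrix}\in X,$$ where the upper $0$ is the zero vector with 4 components. For $h>0$ the one-step map of the symmetric exponential integrator is $$\Phi_h\begin{pmatrix}V_1\\ V_2\end{pmatrix}=\begin{pmatrix}e^{2hL}V_2+2h\,e^{hL}F(V_1)\\ V_1\end{pmatrix},\qquad V_1,V_2\in X.$$ *)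

(* Defs.v *)
From mathcomp Require Import all_boot all_order all_algebra.
From mathcomp Require Import all_classical all_reals all_analysis.
From mathcomp Require Import complex.

Set Implicit Arguments.
Unset Strict Implicit.
Unset Printing Implicit Defensive.

Import GRing.Theory Num.Theory numFieldNormedType.Exports.

Local Open Scope classical_set_scope.
Local Open Scope ring_scope.

(* The limit is taken in the (entrywise, sup-norm) topology of 'M[R]_n.+1. *)
Definition expmx (R : realType) (n : nat) (A : 'M[R]_n.+1) : 'M[R]_n.+1 :=
  limn (series (fun k : nat => (k`!%:R)^-1 *: A ^+ k)).

(* The library norm `|z| on matrices is the sup norm, hence this definition. *)
Definition enorm (R : realType) (n : nat) (z : 'cV[R[i]]_n) : R :=
  Num.sqrt (\sum_(j < n) Normc.normc (z j 0) ^+ 2).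

Definition complexify (R : realType) (m n : nat) (A : 'M[R]_(m, n)) :
  'M[R[i]]_(m, n) := map_mx (real_complex R) A.

Definition mx_of_rows (R : pzRingType) (m n : nat) (rows : seq (seq R)) :
  'M[R]_(m, n) := \matrix_(i < m, j < n) nth 0 (nth [::] rows i) j.

Definition state (R : realType) (x : 'cV[R]_3) (t : R[i])
    (v : 'cV[R]_3) (w : R[i]) : 'cV[R[i]]_8 :=
  col_mx (col_mx (complexify x) (const_mx t : 'cV[R[i]]_1))
         (col_mx (complexify v) (const_mx w : 'cV[R[i]]_1)).

Definition state_space (R : realType) : set 'cV[R[i]]_8 :=
  [set U | exists (x v : 'cV[R]_3) (t w : R[i]),
     [/\ complex.Re t = 0, complex.Re w = 0 & U = state x t v w]].

(* Taking real parts discards nothing when U lies in [state_space]. *)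
Definition position (R : realType) (U : 'cV[R[i]]_8) : 'cV[R]_3 :=
  map_mx (@complex.Re R)
    (usubmx (usubmx (U : 'cV[R[i]]_(4 + 4)) : 'cV[R[i]]_(3 + 1))).

Definition velocity (R : realType) (U : 'cV[R[i]]_8) : 'cV[R[i]]_4 :=
  dsubmx (U : 'cV[R[i]]_(4 + 4)).

Lemma position_state (R : realType) (x : 'cV[R]_3) (t : R[i])
    (v : 'cV[R]_3) (w : R[i]) : position (state x t v w) = x.
Proof.
rewrite /position /state !col_mxKu.
by apply/matrixP => j k; rewrite !mxE.
Qed.

Lemma velocity_state (R : realType) (x : 'cV[R]_3) (t : R[i])
    (v : 'cV[R]_3) (w : R[i]) :
  velocity (state x t v w) =
    col_mx (complexify v) (const_mx w : 'cV[R[i]]_1).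
Proof. by rewrite /velocity /state col_mxKd. Qed.

(* In the next two definitions b and e are the values of the fields at a point;
   their components b 0 0, b 1 0, b 2 0 are B_1, B_2, B_3. *)
Definition Bhat (R : realType) (b : 'cV[R]_3) : 'M[R]_4 :=
  mx_of_rows 4 4
    [:: [::       0;   b 2 0; - b 1 0; 0];
        [:: - b 2 0;       0;   b 0 0; 0];
        [::   b 1 0; - b 0 0;       0; 0];
        [::       0;       0;       0; 0] ].

Definition Ehat (R : realType) (e : 'cV[R]_3) : 'M[R[i]]_4 :=
  let ie (k : 'I_3) : R[i] := 'i%C * (e k 0)%:C%C in
  mx_of_rows 4 4
    [:: [::    0;    0;    0; - ie 0];
        [::    0;    0;    0; - ie 1];
        [::    0;    0;    0; - ie 2];
        [:: ie 0; ie 1; ie 2;      0] ].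

Definition Gmx (R : realType) (B E : 'cV[R]_3 -> 'cV[R]_3) (x0 x : 'cV[R]_3) :
  'M[R[i]]_4 := complexify (Bhat (B x)) - complexify (Bhat (B x0)) + Ehat (E x).

Definition Lmx (R : realType) (B : 'cV[R]_3 -> 'cV[R]_3) (x0 : 'cV[R]_3) :
  'M[R]_8 := block_mx (0 : 'M[R]_4) (1%:M : 'M[R]_4) 0 (Bhat (B x0)).

Definition Fvec (R : realType) (B E : 'cV[R]_3 -> 'cV[R]_3) (x0 : 'cV[R]_3)
    (U : 'cV[R[i]]_8) : 'cV[R[i]]_8 :=
  col_mx (0 : 'cV[R[i]]_4) (Gmx B E x0 (position U) *m velocity U).

Definition Phi (R : realType) (B E : 'cV[R]_3 -> 'cV[R]_3) (x0 : 'cV[R]_3)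
    (h : R) (V : 'cV[R[i]]_(8 + 8)) : 'cV[R[i]]_(8 + 8) :=
  let V1 := usubmx V in
  let V2 := dsubmx V in
  col_mx (complexify (expmx ((2 * h) *: Lmx B x0)) *m V2
          + (2 * h)%:C%C *:
              (complexify (expmx (h *: Lmx B x0)) *m Fvec B E x0 V1))
         V1.

(* Main.v *)
Require Import Defs.
From HB Require Import structures.
From mathcomp Require Import all_boot all_order all_algebra.
From mathcomp Require Import all_classical all_reals all_analysis.
From mathcomp Require Import complex.

Set Implicit Arguments.
Unset Strict Implicit.
Unset Printing Implicit Defensive.

Import Order.TTheory GRing.Theory Num.Theory numFieldNormedType.Exports.

Local Open Scope classical_set_scope.
Local Open Scope ring_scope.

(** Write [D = (d1, d2)] for the difference of the two pairs of states, and
    [f] for the difference of the two values of the nonlinearity. The difference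
    of the images under [Phi] is
      [(d2, d1) + (b, 0)]  with
      [b = (e^(2hL) - 1) d2 + 2h e^(hL) f].
    The swap [(d1, d2) -> (d2, d1)] preserves the Euclidean norm, so everything
    rests on the perturbation [b] being [O(h)] times the norm of [D].

    For the first term this is the exponential bound [norm_expmx_sub1]:
    [|e^(hA) - 1| <= h e^(n|A|)] in the sup norm when [0 < h <= 1], because each
    term of the series but the first carries at least one factor [h]. The same
    bound keeps [e^(hL)] bounded, and the second term has its own factor [2h],
    so it remains to have [|f| <= q |D|] for some [q] independent of [h]. As the
    four states are given before the constant is chosen, [q] can be the quotient
    of the two norms if [D] is nonzero, while [D = 0] forces [f = 0]: the
    resulting constant depends on the states.

    Finally, adding a vector whose [n] entries are bounded by [beta] increases
    the Euclidean norm by at most [n * beta] ([enorm_add_le]); the leading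
    coefficient 1 in front of the norm of [D] is thus retained. *)

(** * The matrix exponential near the identity *)

(** Matrices are complete and normed; joining the two structures makes the
    absolute convergence criterion for series applicable to them. *)
HB.instance Definition _ (R : realType) (m n : nat) :=
  Complete.on 'M[R]_(m.+1, n.+1).

Lemma entry_le_norm (R : realType) (m n : nat) (A : 'M[R]_(m, n)) i j :
  `|A i j| <= `|A|.
Proof.
rewrite [leRHS]/Num.Def.normr /= mx_normrE.
by apply/bigmax_geP; right; exists (i, j).
Qed.

Lemma norm_le_entry (R : realType) (m n : nat) (A : 'M[R]_(m, n)) c :
  0 <= c -> (forall i j, `|A i j| <= c) -> `|A| <= c.
Proof.
move=> c0 Ac; rewrite [leLHS]/Num.Def.normr /= mx_normrE.
by apply/bigmax_leP; split=> // -[i j] _; exact: Ac.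
Qed.

(** The sup norm is submultiplicative only up to the inner dimension; hence the
    factor [n] next to [|A|] in all the bounds on the exponential below. *)
Lemma norm_mulmx (R : realType) (m n p : nat) (A : 'M[R]_(m, n))
    (B : 'M[R]_(n, p)) : `|A *m B| <= n%:R * `|A| * `|B|.
Proof.
apply: norm_le_entry => [|i j]; first by rewrite !mulr_ge0.
rewrite mxE (le_trans (ler_norm_sum _ _ _))//.
have -> : n%:R * `|A| * `|B| = \sum_(k < n) `|A| * `|B|.
  by rewrite sumr_const card_ord -mulrA mulr_natl.
apply: ler_sum => k _.
by rewrite normrM ler_pM ?entry_le_norm.
Qed.

Lemma norm_exprmx (R : realType) (n : nat) (A : 'M[R]_n.+1) k :
  `|A ^+ k| <= (n.+1%:R * `|A|) ^+ k.
Proof.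
elim: k => [|k IHk].
  rewrite !expr0; apply: norm_le_entry => // i j.
  by rewrite !mxE; case: (i == j); rewrite ?normr0 ?normr1.
rewrite !exprS (le_trans (norm_mulmx _ _))// ler_wpM2l ?mulr_ge0//.
Qed.

Lemma norm_exp_term (R : realType) (n : nat) (A : 'M[R]_n.+1) k :
  `|(k`!%:R)^-1 *: A ^+ k| <= exp_coeff (n.+1%:R * `|A|) k.
Proof.
rewrite normrZ /exp_coeff /= mulrC normfV normr_nat ler_wpM2r ?invr_ge0//.
exact: norm_exprmx.
Qed.

Lemma cvg_expmx (R : realType) (n : nat) (A : 'M[R]_n.+1) :
  cvgn (series (fun k : nat => (k`!%:R)^-1 *: A ^+ k)).
Proof.
apply: normed_cvg.
apply: series_le_cvg (is_cvg_series_exp_coeff (n.+1%:R * `|A|)) => // k.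
- exact: normr_ge0.
- by apply: exp_coeff_ge0; rewrite mulr_ge0.
- exact: norm_exp_term.
Qed.

Lemma series_exp_coeff_le_expR (R : realType) (x : R) N :
  0 <= x -> series (exp_coeff x) N <= expR x.
Proof.
move=> x0; apply: nondecreasing_cvgn_le (is_cvg_series_exp_coeff x) N.
by apply: nondecreasing_series => k _ _; exact: exp_coeff_ge0.
Qed.

(** After the term of index 0, which cancels the identity, the term of index [k]
    is at most [h^k c^k / k!] with [c = n |A|], and [h^k <= h] for [k >= 1] and
    [h <= 1]. Factoring out [h] leaves partial sums of the series of [e^c]. *)
Lemma norm_expmx_sub1 (R : realType) (n : nat) (A : 'M[R]_n.+1) (h : R) :
  0 < h <= 1 -> `|expmx (h *: A) - 1| <= h * expR (n.+1%:R * `|A|).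
Proof.
move=> /andP[h0 h1].
have cvgS := @cvg_expmx _ _ (h *: A).
have cvgS1 : (series (fun k => (k`!%:R)^-1 *: (h *: A) ^+ k) N - 1)
    @[N --> \oo] --> expmx (h *: A) - 1.
  by apply: cvgB => //; exact: cvg_cst.
rewrite -(cvg_lim (@Rhausdorff R) (cvg_norm cvgS1)).
apply: limr_le; first by apply: cvgP (cvg_norm cvgS1).
exists 1%N => // N /= N1.
set c := n.+1%:R * `|A|.
have c0 : 0 <= c by rewrite mulr_ge0.
rewrite seriesEnat /= big_ltn// fact0 invr1 scale1r expr0 addrAC subrr add0r.
apply: (@le_trans _ _ (h * series (exp_coeff c) N)); last first.
  by rewrite ler_pM2l// series_exp_coeff_le_expR.
rewrite (le_trans (ler_norm_sum _ _ _))// seriesEnat /= (big_ltn N1).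
rewrite mulrDr mulr_sumr ler_wpDl ?mulr_ge0 ?exp_coeff_ge0 ?(ltW h0)//.
rewrite big_nat [leRHS]big_nat; apply: ler_sum => k /andP[k1 _].
rewrite exprZn scalerA mulrC -scalerA normrZ ler_pM ?norm_exp_term//.
rewrite normrX gtr0_norm//.
by case: k k1 => // k _; rewrite exprS ler_piMr ?(ltW h0)// exprn_ile1 ?(ltW h0).
Qed.

(** * The Euclidean norm of complex columns *)

Local Notation normc := Normc.normc.

Lemma normc_ge0 (R : rcfType) (z : R[i]) : 0 <= normc z.
Proof. by case: z => a b; exact: sqrtr_ge0. Qed.

(** Restates [le_normcD], which lives on the copy [Rcomplex R] of [R[i]] and so
    does not unify with sums in [R[i]]. *)
Lemma normc_add (R : rcfType) (x y : R[i]) :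
  normc (x + y) <= normc x + normc y.
Proof. exact: (le_normcD (x : Rcomplex R) y). Qed.

Lemma normc_sum (R : rcfType) (I : Type) (r : seq I) (f : I -> R[i]) :
  normc (\sum_(i <- r) f i) <= \sum_(i <- r) normc (f i).
Proof.
elim/big_ind2: _ => //; first by rewrite Normc.normc0.
move=> x1 x2 y1 y2 le1 le2.
exact: le_trans (normc_add _ _) (lerD le1 le2).
Qed.

Lemma normc_real (R : rcfType) (a : R) : normc a%:C%C = `|a|.
Proof. by rewrite /Normc.normc /= expr0n addr0 sqrtr_sqr. Qed.

Lemma enorm_ge0 (R : realType) n (z : 'cV[R[i]]_n) : 0 <= enorm z.
Proof. exact: sqrtr_ge0. Qed.

Lemma enorm_sqr (R : realType) n (z : 'cV[R[i]]_n) :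
  enorm z ^+ 2 = \sum_(j < n) normc (z j 0) ^+ 2.
Proof. by rewrite sqr_sqrtr// sumr_ge0// => j _; rewrite sqr_ge0. Qed.

Lemma entry_le_enorm (R : realType) n (z : 'cV[R[i]]_n) j :
  normc (z j 0) <= enorm z.
Proof.
rewrite -(ler_pXn2r (_ : 0 < 2)%N) ?nnegrE ?normc_ge0 ?enorm_ge0//.
by rewrite enorm_sqr (bigD1 j)//= lerDl sumr_ge0// => i _; rewrite sqr_ge0.
Qed.

Lemma enorm_eq0 (R : realType) n (z : 'cV[R[i]]_n) : enorm z = 0 -> z = 0.
Proof.
move=> z0; apply/matrixP => j k; rewrite ord1 mxE.
apply: Normc.eq0_normc; apply/eqP.
by rewrite eq_le normc_ge0 andbT -z0 entry_le_enorm.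
Qed.

(** A weak form of the triangle inequality that needs no Cauchy-Schwarz: by
    [|a_j + b_j|^2 <= |a_j|^2 + 2 |a_j| beta + beta^2] and [|a_j| <= |a|], the
    sum over [j] is at most [|a|^2 + 2 n |a| beta + n beta^2], which is below
    [(|a| + n beta)^2] since [n <= n^2]. *)
Lemma enorm_add_le (R : realType) n (a b : 'cV[R[i]]_n) (beta : R) :
  0 <= beta -> (forall j, normc (b j 0) <= beta) ->
  enorm (a + b) <= enorm a + n%:R * beta.
Proof.
move=> beta0 b_le.
have rhs0 : 0 <= enorm a + n%:R * beta by rewrite addr_ge0 ?enorm_ge0 ?mulr_ge0.
rewrite -(ler_pXn2r (_ : 0 < 2)%N) ?nnegrE ?enorm_ge0//.
rewrite sqrrD enorm_sqr.
apply: (@le_trans _ _ (\sum_(j < n)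
    (normc (a j 0) ^+ 2 + (enorm a * beta *+ 2 + beta ^+ 2)))).
  apply: ler_sum => j _; rewrite mxE.
  apply: (@le_trans _ _ ((normc (a j 0) + beta) ^+ 2)).
    rewrite ler_pXn2r ?nnegrE ?normc_ge0 ?addr_ge0 ?normc_ge0//.
    by rewrite (le_trans (normc_add _ _))// lerD2l.
  rewrite sqrrD -addrA lerD2l lerD2r lerMn2r/= ler_wpM2r//.
  exact: entry_le_enorm.
rewrite big_split/= -enorm_sqr sumr_const card_ord -[leRHS]addrA lerD2l mulrnDl.
rewrite -mulrnA mulnC mulrnA [in leRHS]mulr_natl mulrnAr lerD2l exprMn_n.
rewrite ler_wpMn2l ?sqr_ge0//.
by case: n {a b b_le rhs0} => // n; rewrite expnS leq_pmulr.
Qed.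

Lemma normc_mulmx (R : realType) m n (M : 'M[R]_(m, n)) (z : 'cV[R[i]]_n) j :
  normc ((complexify M *m z) j 0) <= n%:R * `|M| * enorm z.
Proof.
rewrite mxE (le_trans (normc_sum _ _))//.
have -> : n%:R * `|M| * enorm z = \sum_(k < n) `|M| * enorm z.
  by rewrite sumr_const card_ord -mulrA mulr_natl.
apply: ler_sum => k _; rewrite mxE Normc.normcM normc_real.
by rewrite ler_pM ?normc_ge0 ?entry_le_norm ?entry_le_enorm.
Qed.

Lemma sqr_enorm_col_mx (R : realType) m n (a : 'cV[R[i]]_m) (b : 'cV[R[i]]_n) :
  enorm (col_mx a b) ^+ 2 = enorm a ^+ 2 + enorm b ^+ 2.
Proof.
rewrite !enorm_sqr big_split_ord/=.
by congr (_ + _); apply: eq_bigr => j _; rewrite ?col_mxEu ?col_mxEd.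
Qed.

Lemma enorm_col_mxC (R : realType) m n (a : 'cV[R[i]]_m) (b : 'cV[R[i]]_n) :
  enorm (col_mx a b) = enorm (col_mx b a).
Proof.
apply/eqP; rewrite -(eqrXn2 (_ : 0 < 2)%N) ?enorm_ge0//.
by rewrite !sqr_enorm_col_mx addrC.
Qed.

Lemma enorm_le_col_mxr (R : realType) m n (a : 'cV[R[i]]_m) (b : 'cV[R[i]]_n) :
  enorm b <= enorm (col_mx a b).
Proof.
rewrite -(ler_pXn2r (_ : 0 < 2)%N) ?nnegrE ?enorm_ge0//.
by rewrite sqr_enorm_col_mx lerDr sqr_ge0.
Qed.

(** * The one-step estimate *)

Theorem proposition2p1 (R : realType) (B E : 'cV[R]_3 -> 'cV[R]_3)
    (x0 : 'cV[R]_3) (V1 V2 W1 W2 : 'cV[R[i]]_8)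
    (hV1 : state_space V1) (hV2 : state_space V2)
    (hW1 : state_space W1) (hW2 : state_space W2) :
  exists2 C : R, 0 < C &
    forall h : R, 0 < h <= 1 ->
      enorm (Phi B E x0 h (col_mx V1 V2) - Phi B E x0 h (col_mx W1 W2))
      <= (1 + C * h) * enorm (col_mx V1 V2 - col_mx W1 W2).
Proof.
set f := Fvec B E x0 V1 - Fvec B E x0 W1.
rewrite opp_col_mx add_col_mx.
set d1 := V1 - W1; set d2 := V2 - W2; set N := enorm (col_mx d1 d2).
have [q q0 fN] : exists2 q, 0 <= q & enorm f = q * N.
  have [N0|N0] := eqVneq N 0; last first.
    by exists (enorm f / N); rewrite ?divfK// divr_ge0 ?enorm_ge0.
  have /eqP := enorm_eq0 N0; rewrite col_mx_eq0 subr_eq0 => /andP[/eqP eVW _].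
  exists 0 => //; rewrite mul0r /f eVW subrr /enorm big1 ?sqrtr0// => j _.
  by rewrite mxE Normc.normc0 expr0n.
(* 8 is the size of L in the bounds on the exponential. *)
pose K2 := expR (8%:R * `|2 *: Lmx B x0|).
pose K1 := expR (8%:R * `|Lmx B x0|).
have K10 : 0 <= K1 := expR_ge0 _.
have K20 : 0 <= K2 := expR_ge0 _.
pose c := 8%:R * K2 + 2 * (8%:R * (1 + K1) * q).
have K1p : 0 <= 1 + K1 by rewrite addr_ge0.
have c0 : 0 <= c by rewrite addr_ge0 // !mulr_ge0.
(* 16 is the length of a pair of states, from the weak triangle inequality;
   the summand 1 makes the constant positive even if c = 0. *)
exists (16%:R * c + 1); first by rewrite ltr_wpDl ?mulr_ge0.
move=> h h01; have /andP[h0 h1] := h01.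
have N0 : 0 <= N := enorm_ge0 _.
rewrite /Phi !col_mxKu !col_mxKd opp_col_mx add_col_mx -/d1.
set M2 := expmx ((2 * h) *: Lmx B x0); set M1 := expmx (h *: Lmx B x0).
have M2le : `|M2 - 1| <= h * K2.
  by rewrite /M2 mulrC -scalerA; exact: norm_expmx_sub1.
have M1le : `|M1| <= 1 + K1.
  rewrite -[M1](subrK 1) addrC (le_trans (ler_normD _ _))//.
  apply: lerD; first by rewrite -(expr0 M1) (le_trans (norm_exprmx _ _)).
  by rewrite (le_trans (norm_expmx_sub1 _ h01))// ler_piMl.
pose b : 'cV[R[i]]_8 :=
  complexify (M2 - 1) *m d2 + (2 * h)%:C%C *: (complexify M1 *m f).
have -> : col_mx (complexify M2 *m V2 + (2 * h)%:C%C *: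
      (complexify M1 *m Fvec B E x0 V1) -
    (complexify M2 *m W2 + (2 * h)%:C%C *:
      (complexify M1 *m Fvec B E x0 W1))) d1
    = col_mx d2 d1 + col_mx b 0.
  rewrite add_col_mx addr0; congr col_mx.
  rewrite /b /complexify map_mxB map_mx1 mulmxBl mul1mx addrA.
  rewrite [d2 + _]addrC subrK /d2 /f !mulmxBr scalerBr.
  by rewrite opprD !addrA; congr (_ + _); rewrite addrAC.
have b_le j : normc (col_mx b (0 : 'cV_8) j 0) <= c * h * N.
  rewrite mxE; case: splitP => k _; last first.
    by rewrite mxE Normc.normc0 !mulr_ge0 ?(ltW h0).
  rewrite mxE (le_trans (normc_add _ _))//.
  rewrite [c * h]mulrDl [leRHS]mulrDl.
  apply: lerD.
    rewrite (le_trans (normc_mulmx _ _ _))// -!mulrA ler_wpM2l// mulrA.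
    rewrite ler_pM ?enorm_ge0//; last exact: enorm_le_col_mxr.
    by rewrite mulrC.
  rewrite mxE Normc.normcM normc_real ger0_norm ?mulr_ge0 ?(ltW h0)//.
  rewrite -!mulrA ler_wpM2l// [h * N]mulrC !mulrA [_ * h]mulrC ler_pM2l//.
  rewrite (le_trans (normc_mulmx _ _ _))// fN mulrA ler_wpM2r//.
  by rewrite ler_wpM2r// ler_wpM2l.
have chN0 : 0 <= c * h * N by rewrite !mulr_ge0 ?(ltW h0).
rewrite (le_trans (enorm_add_le _ chN0 b_le))// enorm_col_mxC -/N.
rewrite [leRHS]mulrDl mul1r lerD2l !mulrA ler_wpM2r// ler_wpM2r ?(ltW h0)//.
by rewrite lerDl.
Qed.
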